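(* Let $\mathcal{S}$ be an alphabet. For any path-complete graph $\mathcal{G}=(N,E)$ on $\mathcal{S}$ there exists a covering family of languages $\mathcal{C}_{\mathcal{G}}$ on $\mathcal{S}$ such that the following holds. Given any $n$ and any system $F=\{f_i\}_{i\in\mathcal{S}}$ of continuous maps $f_i:\mathbb{R}^n\to\mathbb{R}^n$, if there is a family $V=\{V_s\}_{s\in N}$ of continuous functions $V_s:\mathbb{R}^n\to\mathbb{R}$ such that $(V,\mathcal{G})$ is a path-complete Lyapunov function for $F$, then there exists a $\mathcal{C}_{\mathcal{G}}$-memory-based Lyapunov function $W:\mathcal{C}_{\mathcal{G}}\times\mathbb{R}^n\to\mathbb{R}$ for $F$ such that, for all $B\in\mathcal{C}_{\mathcal{G}}$, $$W(B,\cdot)\in\Big\{\max_{s\in P}V_s(\cdot)\ :\ \emptyset\neq P\subseteq N\Big\}.$$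
   Context: An alphabet $\mathcal{S}$ is a finite nonempty set of symbols. $\mathcal{S}^\star=\bigcup_{k\in\mathbb{N}}\mathcal{S}^k$ is the set of all finite strings over $\mathcal{S}$, with $\mathcal{S}^0=\{\epsilon\}$ (the empty string). For $h\in\mathcal{S}$ and a string $w=(i_1,\dots,i_K)$, $hw=(h,i_1,\dots,i_K)$ is the string obtained by prepending $h$; for $B\subseteq\mathcal{S}^\star$, $hB=\{hw : w\in B\}$. A regular language is a subset of $\mathcal{S}^\star$ recognized by a finite-state automaton. Covering family of languages: a finite set $\mathcal{C}=\{B_1,\dots,B_M\}$ of regular languages $B_j\subseteq\mathcal{S}^\star$ such that (i) $\bigcup_{j=1}^M B_j=\mathcal{S}^\star$; (ii) for every $B\in\mathcal{C}$ and every $h\in\mathcal{S}$ there exists $C\in\mathcal{C}$ with $hB\subseteq C$. Graph on $\mathcal{S}$: a pair $\mathcal{G}=(N,E)$ with $N$ a finite set of nodes and $E\subseteq N\times N\times\mathcal{S}$ a set of labeled directed edges ($(a,b,i)$ goes from $a$ to $b$ with label $i$). It is path-complete if for every $K\ge1$ and every $(j_1,\dots,j_K)\in\mathcal{S}^K$ there are nodes $a_1,\dots,a_{K+1}\in N$ with $(a_k,a_{k+1},j_k)\in E$ for all $1\le k\le K$. A function $\alpha:[0,\infty)\to[0,\infty)$ is of class $\mathcal{K}_\infty$ if it is continuous, strictly increasing, unbounded and $\alpha(0)=0$. $|\cdot|$ is the Euclidean norm on $\mathbb{R}^n$. Path-complete Lyapunov function (PCLF) for $F=\{f_i\}_{i\in\mathcal{S}}$: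 a pair $(V,\mathcal{G})$ where $\mathcal{G}=(N,E)$ is a path-complete graph on $\mathcal{S}$ and $V=\{V_s\}_{s\in N}$ is a family of continuous functions $V_s:\mathbb{R}^n\to\mathbb{R}$ such that, for some $\alpha_1,\alpha_2\in\mathcal{K}_\infty$ and some $\gamma\in[0,1)$: $\alpha_1(|x|)\le V_s(x)\le\alpha_2(|x|)$ for all $s\in N$, $x\in\mathbb{R}^n$; and $V_b(f_i(x))\le\gamma V_a(x)$ for all $(a,b,i)\in E$, $x\in\mathbb{R}^n$. $\mathcal{C}$-memory-based Lyapunov function for $F$ (with $\mathcal{C}$ a covering family of languages): a function $W:\mathcal{C}\times\mathbb{R}^n\to\mathbb{R}$, continuous (i.e. $W(B,\cdot)$ is continuous for each $B\in\mathcal{C}$), for which there exist $\alpha_1,\alpha_2\in\mathcal{K}_\infty$ and $\gamma\in[0,1)$ such that $\alpha_1(|x|)\le W(B,x)\le\alpha_2(|x|)$ for all $(B,x)\in\mathcal{C}\times\mathbb{R}^n$; and $W(C,f_h(x))\le\gamma W(B,x)$ for all $B\in\mathcal{C}$, all $h\in\mathcal{S}$, all $C\in\mathcal{C}$ with $hB\subseteq C$, and all $x\in\mathbb{R}^n$. *)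

(* Defs.v *)
From mathcomp Require Import all_boot all_order all_algebra.
From mathcomp Require Import all_classical all_reals all_analysis.

Set Implicit Arguments.
Unset Strict Implicit.
Unset Printing Implicit Defensive.

Import Order.TTheory GRing.Theory Num.Theory.
Import numFieldNormedType.Exports.

Local Open Scope classical_set_scope.
Local Open Scope ring_scope.

Section Languages.
Variable Sig : finType.

Record automaton := Automaton {
  state : finType;
  init : state;
  step : state -> Sig -> state;
  final : {set state}
}.

(* Words are read from their first letter to their last. *)
Definition recognized (M : automaton) : set (seq Sig) :=
  [set w | foldl (@step M) (init M) w \in final M].

Definition regular (B : set (seq Sig)) : Prop :=
  exists M : automaton, B = recognized M.

Definition prepend (h : Sig) (B : set (seq Sig)) : set (seq Sig) :=
  [set h :: w | w in B].

Definition covering_family (C : set (set (seq Sig))) : Prop :=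
  [/\ finite_set C,
      (forall B, C B -> regular B),
      \bigcup_(B in C) B = [set: seq Sig] &
      forall B h, C B -> exists2 B', C B' & prepend h B `<=` B'].

End Languages.

(* The triple (a, b, i) is the edge from a to b with label i. *)
Record graph (Sig : finType) := Graph {
  node : finType;
  edge : {set node * node * Sig}
}.

(* For k < K, the index k viewed in 'I_K.+1 is [widen_ord (leqnSn K) k], and
   k + 1 is [lift ord0 k]. *)
Definition path_complete (Sig : finType) (G : graph Sig) : Prop :=
  forall (K : nat) (j : 'I_K -> Sig), (0 < K)%N ->
    exists a : 'I_K.+1 -> node G, forall k : 'I_K,
      (a (widen_ord (leqnSn K) k), a (lift ord0 k), j k) \in edge G.

Section Lyapunov.
Variable R : realType.

(* The library norm of 'rV[R]_n is the sup norm; its topology is the usual one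
   of R^n. *)
Definition euclidean_norm (n : nat) (x : 'rV[R]_n) : R :=
  Num.sqrt (\sum_(i < n) x ord0 i ^+ 2).

(* Only the values of a on [0, +oo[ matter. *)
Definition class_Kinfty (a : R -> R) : Prop :=
  [/\ (forall r, 0 <= r -> 0 <= a r),
      {within [set r : R | 0 <= r], continuous a},
      (forall r s, 0 <= r -> r < s -> a r < a s),
      (forall m : R, exists2 r, 0 <= r & m < a r) &
      a 0 = 0].

Definition is_PCLF (Sig : finType) (n : nat) (F : Sig -> 'rV[R]_n -> 'rV[R]_n)
    (G : graph Sig) (V : node G -> 'rV[R]_n -> R) : Prop :=
  [/\ path_complete G,
      (forall s, continuous (V s)) &
      exists a1 a2 : R -> R, exists gamma : R,
        [/\ class_Kinfty a1,
            class_Kinfty a2,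
            0 <= gamma < 1,
            (forall s x, a1 (euclidean_norm x) <= V s x
                         /\ V s x <= a2 (euclidean_norm x)) &
            forall a b i x, (a, b, i) \in edge G ->
              V b (F i x) <= gamma * V a x]].

(* The coercion [set_type] makes W a function on the languages belonging to C,
   and [set_val] returns the underlying language. *)
Definition is_memory_LF (Sig : finType) (n : nat)
    (F : Sig -> 'rV[R]_n -> 'rV[R]_n) (C : set (set (seq Sig)))
    (W : C -> 'rV[R]_n -> R) : Prop :=
  (forall B : C, continuous (W B)) /\
  exists a1 a2 : R -> R, exists gamma : R,
    [/\ class_Kinfty a1,
        class_Kinfty a2,
        0 <= gamma < 1,
        (forall (B : C) x, a1 (euclidean_norm x) <= W B x
                           /\ W B x <= a2 (euclidean_norm x)) &
        forall (B B' : C) (h : Sig) x,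
          prepend h (set_val B) `<=` set_val B' ->
          W B' (F h x) <= gamma * W B x].

(* R has no least element to serve as neutral element of max, so the iterated
   maximum over P starts from V s0 x for some s0 \in P; the value does not
   depend on the choice of s0, and s0 witnesses that P is nonempty. *)
Definition max_functions (N : finType) (n : nat) (V : N -> 'rV[R]_n -> R) :
    set ('rV[R]_n -> R) :=
  [set g | exists (P : {set N}) (s0 : N),
     s0 \in P /\ g = (fun x => \big[Num.max/V s0 x]_(s in P) V s x)].

End Lyapunov.

(* Main.v *)
Require Import Defs.
From mathcomp Require Import all_boot all_order all_algebra.
From mathcomp Require Import all_classical all_reals all_analysis.
Import Order.TTheory GRing.Theory Num.Theory.
Import numFieldNormedType.Exports.
Local Open Scope classical_set_scope.
Local Open Scope ring_scope.

(** A word lists the most recent letter first.  To a word [w] attach the set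
    [reach w] of end nodes of the paths of the graph that read [w] from its
    oldest letter to its newest one; it is nonempty by path-completeness, and
    [reach (h :: w)] depends only on [h] and [reach w].  The languages are the
    nonempty fibres of [reach], and the function attached to the fibre of [P] is
    the maximum of the [V s] for [s] in [P]: each node of [reach (h :: w)] is
    the target of an edge labeled [h] whose source lies in [reach w]. *)

Definition successors {Sig : finType} (G : graph Sig) (h : Sig)
    (P : {set node G}) : {set node G} :=
  finset (fun b => [exists a in P, (a, b, h) \in edge G]).

Definition reach {Sig : finType} (G : graph Sig) (w : seq Sig) : {set node G} :=
  foldr (successors G) [set: node G]%SET w.

Definition fibre {Sig : finType} (G : graph Sig) (P : {set node G}) :
    set (seq Sig) :=
  [set w | reach G w = P].

Lemma reach_neq0 (Sig : finType) (G : graph Sig) (w : seq Sig) :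
  (0 < #|Sig|)%N -> path_complete G -> exists s, s \in reach G w.
Proof.
move=> /card_gt0P[h0 _] pcG.
(* The extra letter [h0] makes the word nonempty. *)
have [a aP] := pcG (size w).+1 (fun k => nth h0 (rev w) k) isT.
(* Along the path [a], the node at position [k] lies in the set reached by the [k] oldest letters of
   [w]; for [k = size w] this set is [reach G w]. *)
suff aS k : (k <= size w)%N ->
    a (inord k) \in foldl (fun P h => successors G h P) [set: node G]%SET
                      (take k (rev w)).
  exists (a (inord (size w))); have := aS _ (leqnn _).
  by rewrite take_oversize ?size_rev// foldl_rev.
elim: k => [_|k IHk ltkw]; first by rewrite take0 /= inE.
rewrite (take_nth h0) ?size_rev// foldl_rcons inE.
apply/existsP; exists (a (inord k)); rewrite IHk ?(ltnW ltkw)//=.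
have -> : inord k = widen_ord (leqnSn (size w).+1) (inord k).
  by apply: val_inj; rewrite /= !inordK// !ltnS ltnW// ltnW.
have -> : inord k.+1 = lift ord0 (inord k : 'I_(size w).+1).
  by apply: val_inj; rewrite /= /bump /= add1n !inordK// !ltnS// ltnW.
by have := aP (inord k); rewrite inordK// ltnS ltnW.
Qed.

(* The automaton reads the newest letter first, whereas [reach] consumes it
   last, so its states are the set transformers [foldr successors ^~ w]. *)
Lemma regular_fibre (Sig : finType) (G : graph Sig) (P : {set node G}) :
  regular (fibre G P).
Proof.
pose T := {ffun {set node G} -> {set node G}}.
pose stepT (f : T) h : T := [ffun Q => f (successors G h Q)].
exists (@Automaton _ T [ffun Q => Q] stepT
          (finset (fun f : T => f [set: node G]%SET == P))).
(* Generalized over [f], since each letter read composes one more map inside the current state. *)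
have foldE w (f : T) Q : foldl stepT f w Q = f (foldr (successors G) Q w).
  by elim: w f => [|h w IHw] f //=; rewrite IHw ffunE.
apply/seteqP; split => w; rewrite /fibre /recognized /= inE foldE ffunE.
  by move=> <-.
by move/eqP.
Qed.

Lemma covering_family_fibres (Sig : finType) (G : graph Sig) :
  covering_family [set fibre G (reach G w) | w in [set: seq Sig]].
Proof.
split.
- apply: (@sub_finite_set _ _ (fibre G @` [set: {set node G}])).
    by move=> _ [w _ <-]; exists (reach G w).
  exact/finite_image/finite_finset.
- by move=> _ [w _ <-]; exact: regular_fibre.
- by apply/seteqP; split => // w _; exists (fibre G (reach G w)) => //; exists w.
- move=> _ h [w _ <-]; exists (fibre G (reach G (h :: w))); first by exists (h :: w).
  by move=> _ [v vw <-]; rewrite /fibre /= vw.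
Qed.

Lemma continuous_bigmax (R : realType) (T : topologicalType) (I : Type)
    (r : seq I) (p : pred I) (f0 : T -> R) (f : I -> T -> R) :
  continuous f0 -> (forall i, continuous (f i)) ->
  continuous (fun x => \big[Num.max/f0 x]_(i <- r | p i) f i x).
Proof.
move=> cf0 cf; elim: r => [|i r IHr] x.
  by under eq_fun do rewrite big_nil; exact: cf0.
under eq_fun do rewrite big_cons.
case: (p i); last exact: IHr.
by apply: (@continuous_max _ _ (f i)); [exact: cf|exact: IHr].
Qed.

Theorem theorem2 (R : realType) (Sig : finType) (Sig_nonempty : (0 < #|Sig|)%N)
    (G : graph Sig) (G_path_complete : path_complete G) :
  exists2 C : set (set (seq Sig)), covering_family C &
    forall (n : nat) (F : Sig -> 'rV[R]_n -> 'rV[R]_n),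
      (forall i, continuous (F i)) ->
      forall V : node G -> 'rV[R]_n -> R,
        is_PCLF F V ->
        exists2 W : C -> 'rV[R]_n -> R, is_memory_LF F W &
          forall B : C, max_functions V (W B).
Proof.
pose C := [set fibre G (reach G w) | w in [set: seq Sig]].
exists C; first exact: covering_family_fibres.
move=> n F _ V [_ cV [a1 [a2 [gamma [a1K a2K gamma01 Va Vedge]]]]].
have ge0 : 0 <= gamma by case/andP: gamma01.
(* Each language gets a representative word and a node reached by it, which will be the starting
   value of the maximum. *)
have wsP (B : C) : exists ws : seq Sig * node G,
    set_val B = fibre G (reach G ws.1) /\ ws.2 \in reach G ws.1.
  have /set_mem[w _ wB] := valP B.
  have [s sw] := @reach_neq0 _ _ w Sig_nonempty G_path_complete.
  by exists (w, s).
have {wsP}[ws wsP] := choice wsP.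
exists (fun B x => \big[Num.max/V (ws B).2 x]_(s in reach G (ws B).1) V s x); last first.
  by move=> B; exists (reach G (ws B).1), (ws B).2; split => //; case: (wsP B).
split; first by move=> B; exact: continuous_bigmax.
exists a1, a2, gamma; split => //.
  move=> B x; split.
    by apply: le_trans (bigmax_ge_id _ _ _ _); case: (Va (ws B).2 x).
  by apply: bigmax_le => [|s _]; [case: (Va (ws B).2 x)|case: (Va s x)].
move=> B B' h x hBB'.
have [BE _] := wsP B; have [B'E s'P] := wsP B'.
(* A single word of the inclusion suffices: all words of the fibre [B'] share one reach set. *)
have reachE : reach G (h :: (ws B).1) = reach G (ws B').1.
  suff : set_val B' (h :: (ws B).1) by rewrite B'E.
  by apply: hBB'; exists (ws B).1; rewrite ?BE.
have le_max s : s \in reach G (ws B').1 ->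
    V s (F h x) <= gamma * \big[Num.max/V (ws B).2 x]_(s in reach G (ws B).1) V s x.
  rewrite -reachE inE => /existsP[a /andP[aB /Vedge Vas]].
  by rewrite (le_trans (Vas x))// ler_wpM2l// le_bigmax_cond.
(* The starting value must be bounded too; [s'P] puts its node in the reach set. *)
apply: bigmax_le => [|s]; [exact: (le_max _ s'P)|exact: le_max].
Qed.
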